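(* Let $n\ge1$ and $a,b,c_1,\dots,c_n\in\mathbb{C}$, and let $\mathrm{Ref}\subset\mathrm{Mon}\subset\mathrm{GL}_{2^n}(\mathbb{C})$ be the groups defined in the context. Assume that $\mathrm{Mon}$ is irreducible, that is, that $$\alpha\neq\prod_{k=1}^n\gamma_k^{i_k}\quad\text{and}\quad\beta\neq\prod_{k=1}^n\gamma_k^{i_k}\qquad\text{for all }(i_1,\dots,i_n)\in\{0,1\}^n.$$ Then the action of $\mathrm{Ref}$ on $\mathbb{C}^{2^n}$ is irreducible if and only if at most one of the $n+1$ numbers $\gamma_1,\dots,\gamma_n,\alpha\beta^{-1}$ (counted with their indices) is equal to $-1$.
   Context: Put $\alpha=e^{2\pi\sqrt{-1}a}$, $\beta=e^{2\pi\sqrt{-1}b}$, $\gamma_k=e^{2\pi\sqrt{-1}c_k}$ ($k=1,\dots,n$). Let $\mathbf{e}_0,\mathbf{e}_1$ be the standard basis of $\mathbb{C}^2$, identify $\mathbb{C}^{2^n}$ with $(\mathbb{C}^2)^{\otimes n}$, with basis $\mathbf{e}_I=\mathbf{e}_{i_1}\otimes\cdots\otimes\mathbf{e}_{i_n}$, $I=(i_1,\dots,i_n)\in\{0,1\}^n$, and put $|I|=i_1+\cdots+i_n$. For $k=1,\dots,n$, $M_k$ is the linear map acting on the $k$-th tensor factor by $G_k=\begin{pmatrix}1&-\gamma_k^{-1}\\0&\gamma_k^{-1}\end{pmatrix}$ (so $G_k\mathbf{e}_0=\mathbf{e}_0$, $G_k\mathbf{e}_1=-\gamma_k^{-1}\mathbf{e}_0+\gamma_k^{-1}\mathbf{e}_1$)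 and trivially on the other factors. The map $M_0$ is defined by $M_0\mathbf{e}_I=\mathbf{e}_I-v_I\,\mathbf{e}_{1,\dots,1}$, where $$v_{(0,\dots,0)}=(-1)^n\frac{(\alpha-1)(\beta-1)\prod_{k=1}^n\gamma_k}{\alpha\beta},\qquad v_I=(-1)^{n+|I|}\frac{\bigl(\alpha\beta+(-1)^{|I|}\prod_{k=1}^n\gamma_k^{i_k}\bigr)\prod_{k=1}^n\gamma_k^{1-i_k}}{\alpha\beta}\quad(I\ne(0,\dots,0)).$$ $\mathrm{Mon}\subset\mathrm{GL}_{2^n}(\mathbb{C})$ is the group generated by $M_0,M_1,\dots,M_n$ (the monodromy group of Lauricella's hypergeometric system $E_C(a,b,c)$ satisfied by $F_C$). $\mathrm{Ref}$ is the smallest normal subgroup of $\mathrm{Mon}$ containing $M_0$, i.e. the subgroup generated by all $gM_0g^{-1}$, $g\in\mathrm{Mon}$. *)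

(* Defs.v *)
From HB Require Import structures.
From mathcomp Require Import all_boot all_order all_algebra.
From mathcomp Require Import all_classical all_reals all_analysis.
From mathcomp.real_closed Require Import complex.

Set Implicit Arguments.
Unset Strict Implicit.
Unset Printing Implicit Defensive.

Import Order.TTheory GRing.Theory Num.Theory.

Local Open Scope classical_set_scope.
Local Open Scope ring_scope.
Local Open Scope complex_scope.

Definition cexp (R : realType) (z : R[i]) : R[i] :=
  (expR (complex.Re z))%:C * (cos (complex.Im z) +i* sin (complex.Im z)).

Definition exp2pii (R : realType) (z : R[i]) : R[i] :=
  cexp ((2 * pi)%:C * 'i%C * z).

Lemma exp2pii_neq0 (R : realType) (z : R[i]) : exp2pii z != 0.
Proof.
rewrite /exp2pii /cexp; set w := (_ * z).
rewrite mulf_neq0 //; first by rewrite eq_complex /= gt_eqF ?expR_gt0.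
rewrite eq_complex /=; apply/negP => /andP[/eqP c0 /eqP s0].
by have := cos2Dsin2 (complex.Im w); rewrite c0 s0 expr0n addr0 => /eqP; rewrite eq_sym oner_eq0.
Qed.

Section LinearGroups.
Variables (F : fieldType) (N : nat).
Implicit Types (G H S : set 'M[F]_N).

Definition is_subgroup_GL H : Prop :=
  [/\ forall g, H g -> g \in unitmx,
      H 1%:M,
      forall g h, H g -> H h -> H (g *m h) &
      forall g, H g -> H (invmx g)].

Definition is_normal_subgroup_GL G H : Prop :=
  [/\ is_subgroup_GL H,
      H `<=` G &
      forall g h, G g -> H h -> H (g *m h *m invmx g)].

(* If some element of [S] is singular, or if [S] is not contained in [G], the
   intersections below are over the empty family: see [Mk_unit], [M0_unit] and
   [Mon_M0]. *)
Definition generated_subgroup S : set 'M[F]_N := smallest is_subgroup_GL S.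

Definition normal_closure_in G S : set 'M[F]_N :=
  smallest (is_normal_subgroup_GL G) S.

(* Matrices act on column vectors. *)
Definition irreducible_action G : Prop :=
  (0 < N)%N /\
  forall W : {vspace 'cV[F]_N},
    (forall g w, G g -> w \in W -> g *m w \in W) ->
    W = 0%VS \/ W = fullv.

End LinearGroups.

Definition multi_index (n : nat) := {ffun 'I_n -> 'I_2}.

Lemma card_multi_index (n : nat) : #|multi_index n| = (2 ^ n)%N.
Proof. by rewrite card_ffun !card_ord. Qed.

(* The bijection between positions in C^(2^n) and {0,1}^n that numbers the
   basis vectors e_I. *)
Definition index_of (n : nat) (i : 'I_(2 ^ n)) : multi_index n :=
  enum_val (cast_ord (esym (card_multi_index n)) i).

Definition index_weight (n : nat) (I : multi_index n) : nat :=
  (\sum_(k < n) I k)%N.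

Section Monodromy.
Variables (F : fieldType) (n : nat) (alpha beta : F) (gamma : 'I_n -> F).
Implicit Types (I : multi_index n) (k : 'I_n).

(* A_1 (x) ... (x) A_n *)
Definition tensor_mx (A : 'I_n -> 'M[F]_2) : 'M[F]_(2 ^ n) :=
  \matrix_(i, j) \prod_(k < n) A k (index_of i k) (index_of j k).

Definition Gk k : 'M[F]_2 :=
  \matrix_(i < 2, j < 2)
    match val i, val j with
    | 0, 0 => 1
    | 0, _ => - (gamma k)^-1
    | _, 0 => 0
    | _, _ => (gamma k)^-1
    end.

Definition Mk k : 'M[F]_(2 ^ n) :=
  tensor_mx (fun l => if l == k then Gk k else 1%:M).

Definition v I : F :=
  if I == [ffun=> ord0] then
    (-1) ^+ n * ((alpha - 1) * (beta - 1) * \prod_(k < n) gamma k)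
      / (alpha * beta)
  else
    (-1) ^+ (n + index_weight I)
      * ((alpha * beta + (-1) ^+ index_weight I * \prod_(k < n) gamma k ^+ I k)
           * \prod_(k < n) gamma k ^+ (1 - I k))
      / (alpha * beta).

(* Column [j] is e_I - v_I e_(1,...,1), for I := index_of j. *)
Definition M0 : 'M[F]_(2 ^ n) :=
  \matrix_(i, j) ((i == j)%:R
                  - v (index_of j) * (index_of i == [ffun=> ord_max])%:R).

Definition Mon : set 'M[F]_(2 ^ n) :=
  generated_subgroup (M0 |` range Mk).

Definition Ref : set 'M[F]_(2 ^ n) := normal_closure_in Mon [set M0].

Lemma index_of_bij : bijective (@index_of n).
Proof.
by apply: bij_comp (enum_val_bij (multi_index n)) _; exists (cast_ord (card_multi_index n));
  [exact: cast_ordKV | exact: cast_ordK].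
Qed.

Lemma tensor_mxM (A B : 'I_n -> 'M[F]_2) :
  tensor_mx A *m tensor_mx B = tensor_mx (fun k => A k *m B k).
Proof.
apply/matrixP => i j; rewrite !mxE.
under [RHS]eq_bigr do rewrite mxE.
rewrite bigA_distr_bigA /= [RHS](reindex _ (onW_bij _ index_of_bij)) /=.
by apply: eq_bigr => k _; rewrite !mxE -big_split.
Qed.

Lemma tensor_mx1 : tensor_mx (fun=> 1%:M) = 1%:M.
Proof.
apply/matrixP => i j; rewrite !mxE.
have [<-|nij] := eqVneq i j; first by rewrite big1 // => k _; rewrite mxE eqxx.
have /ffunP/existsNP[k /eqP nk] : index_of i <> index_of j.
  by move/(bij_inj index_of_bij)/eqP; rewrite (negPf nij).
by rewrite (bigD1 k) //= mxE (negPf nk) mul0r.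
Qed.

Lemma Mk_unit k : gamma k != 0 -> Mk k \in unitmx.
Proof.
move=> gk; pose H : 'M[F]_2 := \matrix_(i < 2, j < 2)
  match val i, val j with 0, 0 => 1 | 0, _ => 1 | _, 0 => 0 | _, _ => gamma k end.
have GH : Gk k *m H = 1%:M.
  apply/matrixP => -[[|[|//]] ?] [[|[|//]] ?]; rewrite !mxE !big_ord_recl big_ord0 !mxE /=;
  by rewrite ?mulr1 ?mul1r ?mulr0 ?mul0r ?addr0 ?add0r ?mulNr ?mulVf ?subrr.
suff /mulmx1_unit[] : Mk k *m tensor_mx (fun l => if l == k then H else 1%:M) = 1%:M by [].
rewrite tensor_mxM -tensor_mx1; congr tensor_mx; apply/funext => l.
by case: eqP => // _; rewrite mulmx1.
Qed.

Lemma M0_unit : (0 < n)%N -> alpha != 0 -> beta != 0 ->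
  (forall k, gamma k != 0) -> M0 \in unitmx.
Proof.
move=> n0 a0 b0 g0; pose o : multi_index n := [ffun=> ord_max].
have [f idxK fK] := index_of_bij.
pose e : 'cV[F]_(2 ^ n) := \col_i (index_of i == o)%:R.
pose w : 'rV[F]_(2 ^ n) := \row_j v (index_of j).
have M0E : M0 = 1%:M - e *m w.
  apply/matrixP => i j; rewrite !mxE big_ord1 !mxE.
  by rewrite [X in _ = _ - X]mulrC.
have weE : w *m e = (v o)%:M.
  apply/matrixP => i j; rewrite !ord1 !mxE (bigD1 (f o)) //= !mxE fK eqxx mulr1.
  rewrite big1 ?addr0 // => l nl; rewrite !mxE; case: eqP => [lo|]; last by rewrite mulr0.
  by rewrite -lo idxK eqxx in nl.
have wo : index_weight o = n.
  by rewrite /index_weight; under eq_bigr do rewrite ffunE; rewrite sum1_card card_ord.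
have vo : 1 - v o = - ((-1) ^+ n * \prod_(k < n) gamma k / (alpha * beta)).
  rewrite /v ifN; last first.
    by apply/eqP => /ffunP/(_ (Ordinal n0)); rewrite !ffunE.
  rewrite wo addnn -mul2n exprM sqrrN expr1n expr1n mul1r.
  rewrite [X in _ * X / _]big1 ?mulr1; last by move=> k _; rewrite ffunE.
  have -> : \prod_(k < n) gamma k ^+ o k = \prod_(k < n) gamma k.
    by apply: eq_bigr => k _; rewrite ffunE.
  by rewrite mulrDl divff ?mulf_neq0 // opprD addrA subrr add0r.
have vo0 : 1 - v o != 0.
  rewrite vo oppr_eq0 !mulf_neq0 ?invr_eq0 ?mulf_neq0 ?signr_eq0 //.
  by apply/prodf_neq0 => k _.
suff /mulmx1_unit[] : M0 *m (1%:M + (1 - v o)^-1 *: (e *m w)) = 1%:M by [].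
rewrite M0E mulmxDr mulmx1 -scalemxAr mulmxBl mul1mx.
rewrite mulmxA -(mulmxA e w e) weE mul_mx_scalar -scalemxAl.
rewrite -{2}(scale1r (e *m w)) -scalerBl scalerA mulVf // scale1r.
by rewrite subrK.
Qed.

Lemma Mon_M0 : Mon M0.
Proof. by move=> H [_]; apply; left. Qed.

End Monodromy.

(* Main.v *)
Require Import Defs.
From mathcomp Require Import all_boot all_order all_algebra.
From mathcomp Require Import all_classical all_reals all_analysis.
From mathcomp.real_closed Require Import complex.
From mathcomp Require Import ring.

(** Write [M0 = 1 - e v] with [e = e_(1,...,1)].  A [Ref]-stable subspace [W]
    is stable under all reflections [h M0 h^-1], [h] in [Mon], so that [h e] lies
    in [W] or [v h^-1] kills [W].  The row [v] is a combination of three pure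
    tensors,
      v = (-1)^n (prod (gamma_k, -1) + (prod gamma_k / (alpha beta)) prod (1, 1)
            - ((alpha + beta) prod gamma_k / (alpha beta)) prod (1, 0)),
    and takes the value +- (g - alpha) (g - beta) * (nonzero) on the joint
    eigenvectors of the commuting [M_k], where [g] is the product of some of the
    [gamma_k].  Hence, if no [h e] lies in [W], then [W = 0].
    If [h e] is in [W] and [v g e != 0], then [h g^-1 e] is in [W].  Since
    [v M_k e = 1 + gamma_k^-1] for [n > 1] and
    [v M_1...M_n e = prod (1 + gamma_k^-1) - (alpha + beta) / (alpha beta)], the set
    of these [h] is stable under all [M_k] when at most one of the numbers is -1,
    and then [W] is everything.
    Conversely, if two of the numbers are -1, there is an involution [J != 1] acting
    on the corresponding one or two tensor factors, with [J e = e], [v J = v] and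
    [M_k J = +- J M_k]; it commutes with [Ref], whose action preserves the
    1-eigenspace of [J]. *)

Set Implicit Arguments.
Unset Strict Implicit.
Unset Printing Implicit Defensive.

Import GRing.Theory.

Local Open Scope ring_scope.

Lemma forall_ord2 (P : 'I_2 -> Prop) : P ord0 -> P ord_max -> forall i, P i.
Proof.
move=> P0 P1 [[|[|//]] lti].
  by rewrite (_ : Ordinal lti = ord0) //; apply: val_inj.
by rewrite (_ : Ordinal lti = ord_max) //; apply: val_inj.
Qed.

Lemma big_ord2 (F : fieldType) (f : 'I_2 -> F) : \sum_i f i = f ord0 + f ord_max.
Proof.
rewrite !big_ord_recl big_ord0 addr0; congr (_ + f _).
exact: val_inj.
Qed.

Lemma lincombE (F : fieldType) m p a (A : 'M[F]_(m, p)) b (B : 'M[F]_(m, p)) i j :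
  (a *: A + b *: B) i j = a * A i j + b * B i j.
Proof. by rewrite !mxE. Qed.

(** * Pure tensors *)

Section Tensors.
Context {F : fieldType} {n : nat}.
Implicit Types (k l : 'I_n) (A : 'I_n -> 'M[F]_2) (u : 'I_n -> 'cV[F]_2).
Implicit Types (r : 'I_n -> 'rV[F]_2).

Definition upd (T : Type) (f : 'I_n -> T) k x : 'I_n -> T :=
  fun l => if l == k then x else f l.

Lemma upd_upd (T : Type) (f : 'I_n -> T) k x y : upd (upd f k x) k y = upd f k y.
Proof. by apply/funext => l; rewrite /upd; case: eqP. Qed.

Lemma upd_id (T : Type) (f : 'I_n -> T) k : upd f k (f k) = f.
Proof. by apply/funext => l; rewrite /upd; case: eqP => // ->. Qed.

Lemma upd_eq (T : Type) (f : 'I_n -> T) k x : upd f k x k = x.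
Proof. by rewrite /upd eqxx. Qed.

Definition col2 (a b : F) : 'cV[F]_2 := \col_i (if i == ord0 then a else b).
Definition row2 (a b : F) : 'rV[F]_2 := \row_j (if j == ord0 then a else b).

Lemma row2E (x : 'rV[F]_2) : x = row2 (x 0 ord0) (x 0 ord_max).
Proof. by apply/matrixP => i; apply: forall_ord2; rewrite !mxE !ord1. Qed.

Definition tensor_col (u : 'I_n -> 'cV[F]_2) : 'cV[F]_(2 ^ n) :=
  \col_i \prod_k u k (index_of i k) 0.

Definition tensor_row (r : 'I_n -> 'rV[F]_2) : 'rV[F]_(2 ^ n) :=
  \row_j \prod_k r k 0 (index_of j k).

Lemma tensor_mx_col A u :
  tensor_mx A *m tensor_col u = tensor_col (fun k => A k *m u k).
Proof.
apply/matrixP => i j; rewrite !mxE.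
under [RHS]eq_bigr do rewrite mxE.
rewrite bigA_distr_bigA /= [RHS](reindex _ (onW_bij _ (@index_of_bij n))) /=.
by apply: eq_bigr => k _; rewrite !mxE -big_split.
Qed.

Lemma tensor_row_mx r A :
  tensor_row r *m tensor_mx A = tensor_row (fun k => r k *m A k).
Proof.
apply/matrixP => i j; rewrite !mxE.
under [RHS]eq_bigr do rewrite mxE.
rewrite bigA_distr_bigA /= [RHS](reindex _ (onW_bij _ (@index_of_bij n))) /=.
by apply: eq_bigr => k _; rewrite !mxE -big_split.
Qed.

Lemma tensor_row_col r u :
  (tensor_row r *m tensor_col u) 0 0 =
  \prod_k (r k 0 ord0 * u k ord0 0 + r k 0 ord_max * u k ord_max 0).
Proof.
under [RHS]eq_bigr do rewrite -(big_ord2 (fun i => r _ 0 i * u _ i 0)).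
rewrite bigA_distr_bigA /= [RHS](reindex _ (onW_bij _ (@index_of_bij n))) /= mxE.
by apply: eq_bigr => k _; rewrite !mxE -big_split.
Qed.

Lemma prod_upd (f : 'I_n -> F) k x :
  \prod_l upd f k x l = x * \prod_(l | l != k) f l.
Proof.
rewrite (bigD1 k) //= upd_eq; congr (_ * _).
by apply: eq_bigr => l /negPf lk; rewrite /upd lk.
Qed.

Lemma tensor_col_upd u k x i :
  tensor_col (upd u k x) i 0 =
  x (index_of i k) 0 * \prod_(l | l != k) u l (index_of i l) 0.
Proof.
rewrite mxE -prod_upd; apply: eq_bigr => l _.
by rewrite /upd; case: eqP => // ->.
Qed.

Lemma tensor_row_upd (r : 'I_n -> 'rV[F]_2) k x j :
  tensor_row (upd r k x) 0 j =
  x 0 (index_of j k) * \prod_(l | l != k) r l 0 (index_of j l).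
Proof.
rewrite mxE -prod_upd; apply: eq_bigr => l _.
by rewrite /upd; case: eqP => // ->.
Qed.

Lemma tensor_mx_upd A k B i j :
  tensor_mx (upd A k B) i j =
  B (index_of i k) (index_of j k) *
  \prod_(l | l != k) A l (index_of i l) (index_of j l).
Proof.
rewrite mxE -prod_upd; apply: eq_bigr => l _.
by rewrite /upd; case: eqP => // ->.
Qed.

Lemma tensor_col_linear u k a x b y :
  tensor_col (upd u k (a *: x + b *: y)) =
  a *: tensor_col (upd u k x) + b *: tensor_col (upd u k y).
Proof.
apply/matrixP => i j; rewrite ord1 lincombE !tensor_col_upd lincombE.
ring.
Qed.

Lemma tensor_row_linear r k a x b y :
  tensor_row (upd r k (a *: x + b *: y)) =
  a *: tensor_row (upd r k x) + b *: tensor_row (upd r k y).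
Proof.
apply/matrixP => i j; rewrite ord1 lincombE !tensor_row_upd lincombE.
ring.
Qed.

Lemma tensor_mx_linear A k a B b C :
  tensor_mx (upd A k (a *: B + b *: C)) =
  a *: tensor_mx (upd A k B) + b *: tensor_mx (upd A k C).
Proof.
apply/matrixP => i j; rewrite lincombE !tensor_mx_upd lincombE.
ring.
Qed.

Lemma tensor_mx_updM k (A B : 'M[F]_2) :
  tensor_mx (upd (fun=> 1%:M) k A) *m tensor_mx (upd (fun=> 1%:M) k B) =
  tensor_mx (upd (fun=> 1%:M) k (A *m B)) :> 'M[F]__.
Proof.
rewrite tensor_mxM; congr tensor_mx; apply/funext => l; rewrite /upd.
by case: eqP => // _; rewrite mul1mx.
Qed.

Lemma tensor_mx_upd1 k : tensor_mx (upd (fun=> 1%:M) k 1%:M) = 1%:M :> 'M[F]__.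
Proof. by rewrite (upd_id (fun=> 1%:M)) tensor_mx1. Qed.

Lemma delta_tensor_col i :
  delta_mx i 0 = tensor_col (fun k => delta_mx (index_of i k) 0).
Proof.
apply/matrixP => j z; rewrite ord1 !mxE eqxx andbT.
have [->|nij] := eqVneq j i; first by rewrite big1 // => k _; rewrite mxE !eqxx.
have /ffunP/existsNP[k /eqP nk] : index_of j <> index_of i.
  by move/(bij_inj (@index_of_bij n))/eqP; rewrite (negPf nij).
by rewrite (bigD1 k) //= mxE (negPf nk) mul0r.
Qed.

Lemma delta_tensor_row i :
  delta_mx 0 i = tensor_row (fun k => delta_mx 0 (index_of i k)).
Proof.
apply/matrixP => z j; rewrite ord1 !mxE eqxx /=.
have [->|nij] := eqVneq j i; first by rewrite big1 // => k _; rewrite mxE !eqxx.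
have /ffunP/existsNP[k /eqP nk] : index_of j <> index_of i.
  by move/(bij_inj (@index_of_bij n))/eqP; rewrite (negPf nij).
by rewrite (bigD1 k) //= mxE (negPf nk) mul0r.
Qed.

(** Turns a coordinate into a pairing with a pure row tensor, which can then be contracted one
    factor at a time. *)
Lemma coord_tensor_row (x : 'cV[F]_(2 ^ n)) i :
  x i 0 = (tensor_row (fun k => delta_mx 0 (index_of i k)) *m x) 0 0.
Proof. by rewrite -delta_tensor_row -rowE mxE. Qed.

End Tensors.

(** * The monodromy group *)

Section MonodromyFacts.
Context {F : fieldType} {n : nat} {alpha beta : F} {gamma : 'I_n -> F}.
Hypotheses (n_gt0 : (0 < n)%N) (alpha0 : alpha != 0) (beta0 : beta != 0).
Hypothesis gamma0 : forall k, gamma k != 0.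
Local Open Scope classical_set_scope.
Local Open Scope ring_scope.
Implicit Types (k l : 'I_n) (u : 'I_n -> 'cV[F]_2) (r : 'I_n -> 'rV[F]_2).

Local Notation M := (Mk gamma).
Local Notation N0 := (M0 alpha beta gamma).
Local Notation Mon := (Mon alpha beta gamma).
Local Notation Ref := (Ref alpha beta gamma).

Definition e_last : 'cV[F]_(2 ^ n) := tensor_col (fun=> col2 0 1).
Definition v_row : 'rV[F]_(2 ^ n) := \row_j v alpha beta gamma (index_of j).

Lemma Mon_min H : is_subgroup_GL H -> H N0 -> (forall k, H (M k)) -> Mon `<=` H.
Proof. by move=> sgH H0 Hk g; apply; split=> // x [->|[k _ <-]]. Qed.

Lemma Mon_Mk k : Mon (M k).
Proof. by move=> H [_]; apply; right; exists k. Qed.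

Lemma unitmx_subgroup_GL m : is_subgroup_GL [set g : 'M[F]_m | g \in unitmx].
Proof.
split=> //= [|g h gu hu|g]; first exact: unitmx1; last by rewrite unitmx_inv.
by rewrite unitmx_mul gu hu.
Qed.

Lemma Mon_unit g : Mon g -> g \in unitmx.
Proof.
apply: (Mon_min (unitmx_subgroup_GL _)) => [|k]; first exact: M0_unit.
exact: Mk_unit.
Qed.

Lemma Mon_subgroup_GL : is_subgroup_GL Mon.
Proof.
split=> [g||g h Mg Mh H sH|g Mg H sH]; first exact: Mon_unit.
- by move=> H [[_ H1 _ _] _].
- by have [[_ _ HM _] _] := sH; apply: HM; [exact: Mg | exact: Mh].
- by have [[_ _ _ HV] _] := sH; apply: HV; exact: Mg.
Qed.

Lemma Mon1 : Mon 1%:M. Proof. by case: Mon_subgroup_GL. Qed.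

Lemma MonM g h : Mon g -> Mon h -> Mon (g *m h).
Proof. by case: Mon_subgroup_GL => _ _ + _; exact. Qed.

Lemma MonV g : Mon g -> Mon (invmx g).
Proof. by case: Mon_subgroup_GL => _ _ _; exact. Qed.

Lemma Ref_conj h : Mon h -> Ref (h *m N0 *m invmx h).
Proof. by move=> Mh H [[_ _ nH] H0]; apply: nH => //; exact: H0. Qed.

Lemma M0E : N0 = 1%:M - e_last *m v_row.
Proof.
apply/matrixP => i j; rewrite !mxE big_ord1 !mxE mulrC; congr (_ - _ * _).
have [->|/eqP neI] := eqVneq (index_of i) _.
  by rewrite big1 // => k _; rewrite ffunE mxE.
have /existsNP[k nk] : ~ forall k, index_of i k = ord_max.
  by move=> Imax; apply: neI; apply/ffunP => k; rewrite ffunE Imax.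
rewrite (bigD1 k) //= mxE.
suff -> : index_of i k = ord0 by rewrite mul0r.
by move: (index_of i k) nk; apply: forall_ord2.
Qed.

Lemma prod_gamma_neq0 : \prod_k gamma k != 0.
Proof. by apply/prodf_neq0 => k _. Qed.

(** For [I] nonzero, the two summands of [v I] factor over the tensor positions and give the first
    two tensors. The third is the indicator of [I = 0], where it turns [alpha beta + 1] into
    [(alpha - 1) (beta - 1)]. *)
Lemma v_rowE :
  v_row = (-1) ^+ n *: (tensor_row (fun k => row2 (gamma k) (-1))
    + ((\prod_k gamma k) / (alpha * beta)) *: tensor_row (fun=> row2 1 1)
    - ((alpha + beta) * (\prod_k gamma k) / (alpha * beta)) *:
        tensor_row (fun=> row2 1 0)).
Proof.
apply/matrixP => i j; rewrite ord1 !mxE /v; move: (index_of j) => I.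
rewrite [X in _ / _ * X]big1 ?mulr1; last by move=> k _; rewrite mxE if_same.
have row1 : \prod_k row2 (gamma k) (-1) 0 (I k) =
    (-1) ^+ index_weight I * \prod_k gamma k ^+ (1 - I k).
  rewrite /index_weight -prodrXr -big_split /=; apply: eq_bigr => k _; rewrite mxE.
  by move: (I k); apply: forall_ord2; rewrite //= ?expr0 ?mul1r ?mulr1 ?expr1.
have row3 : \prod_k row2 1 0 0 (I k) = (I == [ffun=> ord0])%:R :> F.
  have [->|/eqP nI] := eqVneq I _; first by rewrite big1 // => k _; rewrite ffunE mxE.
  have /existsNP[k nk] : ~ forall k, I k = ord0.
    by move=> I0; apply: nI; apply/ffunP => k; rewrite ffunE I0.
  by rewrite (bigD1 k) //= mxE ifN ?mul0r //; apply/eqP.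
rewrite row1 row3.
have [I0|nI] := eqVneq I _.
  have w0 : index_weight I = 0%N.
    by rewrite /index_weight big1 // => k _; rewrite I0 ffunE.
  have -> : \prod_k gamma k ^+ (1 - I k) = \prod_k gamma k.
    by apply: eq_bigr => k _; rewrite I0 ffunE.
  by rewrite w0 expr0 mul1r /=; field; rewrite alpha0 beta0.
have split_gamma : \prod_k gamma k =
    \prod_k gamma k ^+ I k * \prod_k gamma k ^+ (1 - I k).
  rewrite -big_split; apply: eq_bigr => k _ /=.
  by rewrite -exprD subnKC // -ltnS.
rewrite split_gamma exprD.
(* The sign occurs twice in one summand of [v I], so its square must be reduced to 1. *)
have sgn2 : (-1) ^+ index_weight I * (-1) ^+ index_weight I = 1 :> F.
  by rewrite -expr2 sqrr_sign.
rewrite mulr0 subr0; move: (_ ^+ index_weight I) sgn2 => s sgn2.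
by field: sgn2; rewrite alpha0 beta0.
Qed.

Lemma v_tensor_col u :
  (v_row *m tensor_col u) 0 0 =
  (-1) ^+ n * (\prod_k (gamma k * u k ord0 0 - u k ord_max 0)
    + (\prod_k gamma k) / (alpha * beta) * \prod_k (u k ord0 0 + u k ord_max 0)
    - (alpha + beta) * (\prod_k gamma k) / (alpha * beta) * \prod_k u k ord0 0).
Proof.
have lin (x y z : F) (A B C : 'M[F]_1) :
    (x *: (A + y *: B - z *: C)) 0 0 = x * (A 0 0 + y * B 0 0 - z * C 0 0).
  by rewrite !mxE.
rewrite v_rowE -scalemxAl mulmxBl mulmxDl -!scalemxAl lin !tensor_row_col.
congr (_ * (_ + _ * _ - _ * _)); apply: eq_bigr => k _; rewrite !mxE /=.
- by rewrite mulN1r.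
- by rewrite !mul1r.
- by rewrite mul1r mul0r addr0.
Qed.

(** * The matrices [M k] and their relations *)

Local Notation q k := (gamma k)^-1.
Local Notation e := e_last.

Lemma GkE k : Gk gamma k = \matrix_(i, j)
  (if i == ord0 then if j == ord0 then 1 else - q k
   else if j == ord0 then 0 else q k).
Proof. by apply/matrixP; apply: forall_ord2; apply: forall_ord2; rewrite !mxE. Qed.

Lemma Gk_col k x y : Gk gamma k *m col2 x y = col2 (x - q k * y) (q k * y).
Proof.
rewrite GkE; apply/matrixP; apply: forall_ord2 => j; rewrite !mxE big_ord2 !mxE /=.
  by rewrite mul1r mulNr.
by rewrite mul0r add0r.
Qed.

Lemma row_Gk k x y : row2 x y *m Gk gamma k = row2 x (q k * (y - x)).
Proof.
rewrite GkE; apply/matrixP => i; apply: forall_ord2; rewrite !mxE big_ord2 !mxE /=.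
  by rewrite mulr1 mulr0 addr0.
ring.
Qed.

(** Cayley-Hamilton: the trace is [1 + q k] and the determinant [q k], so the eigenvalues are 1 and
    [q k]. *)
Lemma Gk_quadratic k :
  Gk gamma k *m Gk gamma k = (1 + q k) *: Gk gamma k + (- q k) *: 1%:M.
Proof.
rewrite GkE; apply/matrixP; apply: forall_ord2; apply: forall_ord2;
  rewrite lincombE !mxE big_ord2 !mxE /=; ring.
Qed.

Lemma MkE k : M k = tensor_mx (upd (fun=> 1%:M) k (Gk gamma k)).
Proof. by []. Qed.

Lemma Mk_quadratic k : M k *m M k = (1 + q k) *: M k + (- q k) *: 1%:M.
Proof. by rewrite MkE tensor_mx_updM Gk_quadratic tensor_mx_linear tensor_mx_upd1. Qed.

Lemma Mk_inv k : invmx (M k) = (1 + gamma k) *: 1%:M + (- gamma k) *: M k.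
Proof.
have uM := Mk_unit (gamma0 k); apply: (can_inj (mulKmx uM)); rewrite mulmxV //.
rewrite mulmxDr -!scalemxAr mulmx1 Mk_quadratic scalerDr !scalerA addrA -scalerDl.
rewrite mulrNN mulfV // scale1r (_ : 1 + gamma k + _ = 0) ?scale0r ?add0r //.
by field; rewrite gamma0.
Qed.

Lemma Mk_comm k l : M k *m M l = M l *m M k.
Proof.
rewrite !MkE !tensor_mxM; congr tensor_mx; apply/funext => m; rewrite /upd.
have [mk|_] := eqVneq m k; have [ml|_] := eqVneq m l; rewrite ?mulmx1 ?mul1mx //.
by rewrite -mk -ml.
Qed.

Lemma Mk_col k u : M k *m tensor_col u = tensor_col (upd u k (Gk gamma k *m u k)).
Proof.
rewrite MkE tensor_mx_col; congr tensor_col; apply/funext => l; rewrite /upd.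
by case: eqP => [->|]; rewrite ?mul1mx.
Qed.

Lemma row_Mk k r : tensor_row r *m M k = tensor_row (upd r k (r k *m Gk gamma k)).
Proof.
rewrite MkE tensor_row_mx; congr tensor_row; apply/funext => l; rewrite /upd.
by case: eqP => [->|]; rewrite ?mulmx1.
Qed.

(** * Vectors killed by every translate of [v] *)

Definition dead (x : 'cV[F]_(2 ^ n)) := forall h, Mon h -> v_row *m (h *m x) = 0.

Lemma dead_Mk k x : dead x -> dead (M k *m x).
Proof. by move=> dx h Mh; rewrite (mulmxA h); exact: (dx _ (MonM Mh (Mon_Mk k))). Qed.

Lemma deadB x y : dead x -> dead y -> dead (x - y).
Proof. by move=> dx dy h Mh; rewrite !mulmxBr dx // dy // subrr. Qed.

Definition Mk_eigen (y : 'cV[F]_(2 ^ n)) k := M k *m y = y \/ M k *m y = q k *: y.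

(** The [M k] are treated one at a time; since they commute, the eigenvector property for earlier
    indices survives. The case [gamma k = 1], where [Gk] is not diagonalizable, is covered. *)
Lemma dead_joint_eigenvector x (s : seq 'I_n) : dead x -> x != 0 ->
  exists2 y, dead y & y != 0 /\ {in s, forall k, Mk_eigen y k}.
Proof.
move=> dx x0; elim: s => [|k s [y dy [y0 ys]]]; first by exists x.
have [yk|nyk] := eqVneq (M k *m y) y.
  by exists y => //; split=> // l; rewrite inE => /predU1P[->|/ys//]; left.
(* Since [(M k - q k) (M k - 1) = 0], this nonzero vector is an eigenvector for [q k]. *)
exists (M k *m y - y); first exact/deadB/dy/dead_Mk.
split=> [|l]; first by rewrite subr_eq0.
rewrite inE => /predU1P[->|/ys ysl]; [right|rewrite /Mk_eigen].
  rewrite mulmxBr mulmxA Mk_quadratic mulmxDl -!scalemxAl mul1mx.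
  by rewrite scalerDl scale1r scalerBr scaleNr -(addrA (M k *m y)) (addrC (M k *m y)) addrK.
rewrite mulmxBr mulmxA -Mk_comm -mulmxA.
by case: ysl => ->; [left | right; rewrite -scalemxAr scalerBr].
Qed.

(* On a joint eigenvector [y], the ratio of the coordinates with [i_k = 1] and
   [i_k = 0]. *)
Definition eigen_ratio (y : 'cV[F]_(2 ^ n)) k : F := if M k *m y == y then 0 else gamma k - 1.

Lemma row2_split (x y : F) : row2 x y = x *: row2 1 0 + y *: row2 0 1.
Proof.
by apply/matrixP => i; apply: forall_ord2; rewrite lincombE !mxE /= !(mulr0, mulr1, addr0, add0r).
Qed.

(** The row [(1, 0)] times [Gk] is [(1, - q k)]. Pairing [M k y = lambda y] with it gives
    [y_1 = gamma_k (1 - lambda) y_0] in factor [k], which is 0 for [lambda = 1] and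
    [(gamma_k - 1) y_0] for [lambda = q k]. *)
Lemma eigen_row y r k : Mk_eigen y k ->
  tensor_row r *m y = (r k 0 ord0 + eigen_ratio y k * r k 0 ord_max) *:
    (tensor_row (upd r k (row2 1 0)) *m y).
Proof.
move=> yk.
have r01 : tensor_row (upd r k (row2 0 1)) *m y =
    eigen_ratio y k *: (tensor_row (upd r k (row2 1 0)) *m y).
  have : tensor_row (upd r k (row2 1 0)) *m (M k *m y) =
      tensor_row (upd r k (row2 1 0)) *m y - q k *: (tensor_row (upd r k (row2 0 1)) *m y).
    rewrite mulmxA row_Mk upd_eq upd_upd row_Gk row2_split tensor_row_linear scale1r.
    by rewrite sub0r mulrN1 mulmxDl scaleNr mulNmx -scalemxAl.
  move: (tensor_row (upd r k (row2 1 0))) (tensor_row (upd r k (row2 0 1)) *m y).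
  move=> R x; rewrite /eigen_ratio; case: eqP => [-> Rx|nyk].
    have /eqP : q k *: x = 0 by rewrite -[LHS](subKr (R *m y)) -Rx subrr.
    by rewrite scaler_eq0 invr_eq0 (negPf (gamma0 k)) scale0r => /eqP.
  case: yk => // ->; rewrite -scalemxAr => /(congr1 ( *:%R (gamma k))).
  rewrite scalerBr !scalerA mulfV // !scale1r => Rx.
  by rewrite scalerBl scale1r {2}Rx subKr.
have -> : tensor_row r = r k 0 ord0 *: tensor_row (upd r k (row2 1 0)) +
    r k 0 ord_max *: tensor_row (upd r k (row2 0 1)).
  by rewrite -tensor_row_linear -row2_split -row2E upd_id.
by rewrite mulmxDl -!scalemxAl r01 scalerA -scalerDl mulrC [_ * r k 0 _]mulrC.
Qed.

(** Contracting every factor by [eigen_row] leaves a single free scalar. *)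
Lemma joint_eigenvector y : (forall k, Mk_eigen y k) ->
  exists t, y = t *: tensor_col (fun k => col2 1 (eigen_ratio y k)).
Proof.
move=> yk; have rowy r (s : seq 'I_n) : uniq s -> tensor_row r *m y =
    (\prod_(k <- s) (r k 0 ord0 + eigen_ratio y k * r k 0 ord_max)) *:
    (tensor_row (fun k => if k \in s then row2 1 0 else r k) *m y).
  elim: s => [_|k s IH /= /andP[ks us]]; first by rewrite big_nil scale1r.
  rewrite IH // (eigen_row _ (yk k)) (negPf ks) scalerA big_cons mulrC.
  congr (_ *: (tensor_row _ *m _)); apply/funext => l; rewrite /upd inE.
  by case: eqP.
(* The scalar is the coordinate of [y] at [I = 0]. *)
exists ((tensor_row (fun=> row2 1 0) *m y) 0 0).
apply/matrixP => i j; rewrite ord1 coord_tensor_row [RHS]mxE coord_tensor_row.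
rewrite tensor_row_col (rowy _ _ (index_enum_uniq _)) mxE mulrC.
congr (_ * _); last by apply: eq_bigr => k _; rewrite !mxE /= mulr1 mulrC.
by congr ((tensor_row _ *m y) 0 0); apply/funext => k; rewrite mem_index_enum.
Qed.

Hypothesis irr : forall I : multi_index n,
  alpha <> \prod_k gamma k ^+ I k /\ beta <> \prod_k gamma k ^+ I k.

Lemma v_eigenvector (c : 'I_n -> F) : (forall k, c k = 0 \/ c k = gamma k - 1) ->
  (v_row *m tensor_col (fun k => col2 1 (c k))) 0 0 != 0.
Proof.
move=> ck; pose I : multi_index n := [ffun k => if c k == 0 then ord0 else ord_max].
have cI k : 1 + c k = gamma k ^+ I k.
  rewrite ffunE; case: eqP => [->|nc]; first by rewrite addr0.
  by case: (ck k) => // ->; rewrite addrC subrK expr1.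
have prod1 : \prod_k (1 + c k) = \prod_k gamma k ^+ I k.
  by apply: eq_bigr => k _; rewrite cI.
(* Both values of [c k] give [(gamma k - c k) (1 + c k) = gamma k]. *)
have prod2 : \prod_k (gamma k - c k) * \prod_k (1 + c k) = \prod_k gamma k.
  rewrite -big_split; apply: eq_bigr => k _ /=.
  by case: (ck k) => ->; ring.
have g0 : \prod_k (1 + c k) != 0.
  by rewrite prod1; apply/prodf_neq0 => k _; rewrite expf_neq0.
have [/eqP nA /eqP nB] := irr I; rewrite -prod1 in nA nB.
rewrite v_tensor_col; under eq_bigr do rewrite !mxE /= mulr1.
under [X in _ + _ * X]eq_bigr do rewrite !mxE /=.
rewrite [X in _ - _ * X]big1; last by move=> k _; rewrite mxE.
move: (\prod_k (1 + c k)) (\prod_k (gamma k - c k)) g0 nA nB prod2 => g g' g0 nA nB prod2.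
rewrite -prod2 (_ : _ + _ - _ = g' * (g - alpha) * (g - beta) / (alpha * beta)).
  have g'0 : g' != 0.
    by apply/eqP => g'0; have := prod_gamma_neq0; rewrite -prod2 g'0 mul0r eqxx.
  have gA : g - alpha != 0 by rewrite subr_eq0 eq_sym.
  have gB : g - beta != 0 by rewrite subr_eq0 eq_sym.
  by rewrite mulf_neq0 ?signr_eq0 // mulf_neq0 ?invr_eq0 ?mulf_neq0.
by field; rewrite alpha0 beta0.
Qed.

(** A nonzero dead vector would yield a dead joint eigenvector, on which [v] does not vanish. *)
Lemma dead_eq0 x : dead x -> x = 0.
Proof.
move=> dx; apply/eqP; apply: contraT => x0.
have [y dy [y0 ys]] := dead_joint_eigenvector (index_enum 'I_n) dx x0.
have [|t yE] := @joint_eigenvector y; first by move=> k; apply: ys; rewrite mem_index_enum.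
have := dy _ Mon1; rewrite mul1mx yE -scalemxAr => /matrixP/(_ 0 0)/eqP.
rewrite [X in X == _]mxE [X in _ == X]mxE mulf_eq0 => /orP[/eqP t0|].
  by rewrite yE t0 scale0r eqxx in y0.
rewrite (negPf (@v_eigenvector (eigen_ratio y) _)) // => k.
by rewrite /eigen_ratio; case: ifP; [left | right].
Qed.

(** * Stable subspaces *)

Section StableSubspace.
Variable W : {vspace 'cV[F]_(2 ^ n)}.
Hypothesis W_stable : forall g w, Ref g -> w \in W -> g *m w \in W.

Lemma M0_mul w : N0 *m w = w - (v_row *m w) 0 0 *: e.
Proof.
by rewrite M0E mulmxBl mul1mx -mulmxA [in LHS](mx11_scalar (v_row *m w)) mul_mx_scalar.
Qed.

(** This vector is the difference between [w] and its image under the reflection [h M0 h^-1]. *)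
Lemma reflection_mem h w : Mon h -> w \in W ->
  (v_row *m (invmx h *m w)) 0 0 *: (h *m e) \in W.
Proof.
move=> Mh wW; have := memvB wW (W_stable (Ref_conj Mh) wW).
rewrite -!mulmxA M0_mul mulmxBr (mulKVmx (Mon_unit Mh)) subKr.
by rewrite -scalemxAr.
Qed.

(** Apply the reflection attached to [h g^-1] to the vector [h e]: its coefficient is [v g e]. *)
Lemma translate_mem h g : Mon h -> Mon g -> h *m e \in W ->
  (v_row *m (g *m e)) 0 0 != 0 -> h *m invmx g *m e \in W.
Proof.
move=> Mh Mg hW vg; have Mhg := MonM Mh (MonV Mg).
have := reflection_mem Mhg hW.
have -> : h *m e = h *m invmx g *m (g *m e).
  by rewrite !mulmxA mulmxKV ?Mon_unit.
by rewrite mulKmx ?Mon_unit // rpredZeq (negPf vg).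
Qed.

(** If [W] contains no [h e], all coefficients in [reflection_mem] vanish, so every vector of [W] is
    dead. *)
Lemma stable_trivial_or_orbit : W = 0%VS \/ exists2 h, Mon h & h *m e \in W.
Proof.
have [|noh] := pselect (exists2 h, Mon h & h *m e \in W); [by right|left].
apply/eqP; rewrite -subv0; apply/subvP => w wW; rewrite memv0; apply/eqP.
apply: dead_eq0 => h Mh; have Mh' := MonV Mh.
have := reflection_mem Mh' wW; rewrite invmxK rpredZeq => /orP[/eqP vw|hW].
  by rewrite [LHS]mx11_scalar vw raddf0.
by case: noh; exists (invmx h).
Qed.

(** The factor [M k] stands on the right of [h], next to [e], as in [translate_mem]. *)
Definition translation_closed k := forall h, Mon h -> h *m e \in W ->
  h *m M k *m e \in W /\ h *m invmx (M k) *m e \in W.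

(* The quadratic relation makes each of [M k] and its inverse an affine
   function of the other. *)
Lemma translate_Mk_inv h k : h *m e \in W ->
  (h *m M k *m e \in W) = (h *m invmx (M k) *m e \in W).
Proof.
move=> hW; rewrite Mk_inv mulmxDr mulmxDl -!scalemxAr mulmx1 -!scalemxAl.
rewrite rpredDl; last exact: rpredZ.
by rewrite rpredZeq oppr_eq0 (negPf (gamma0 k)).
Qed.

Lemma closed_of_Mk k : (v_row *m (M k *m e)) 0 0 != 0 -> translation_closed k.
Proof.
move=> vk h Mh hW; rewrite translate_Mk_inv //.
by have := translate_mem Mh (Mon_Mk k) hW vk.
Qed.

Lemma closed_of_Mk_inv k :
  (v_row *m (invmx (M k) *m e)) 0 0 != 0 -> translation_closed k.
Proof.
move=> vk h Mh hW; rewrite -translate_Mk_inv //.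
by have := translate_mem Mh (MonV (Mon_Mk k)) hW vk; rewrite invmxK.
Qed.

(** The product of all the [M k], written as one pure tensor. *)
Definition Mk_prod : 'M[F]_(2 ^ n) := tensor_mx (Gk gamma).

Lemma Mk_partial_prod (s : seq 'I_n) k : k \notin s ->
  tensor_mx (fun l => if l \in s then Gk gamma l else 1%:M) *m M k =
  tensor_mx (fun l => if l \in k :: s then Gk gamma l else 1%:M).
Proof.
move=> ks; rewrite MkE tensor_mxM; congr tensor_mx; apply/funext => l.
rewrite /upd inE; case: eqP => [->|_]; first by rewrite (negPf ks) mul1mx.
by rewrite mulmx1.
Qed.

Lemma translate_partial_prod (s : seq 'I_n) h : uniq s ->
  {in s, forall k, translation_closed k} -> Mon h -> h *m e \in W ->
  h *m tensor_mx (fun l => if l \in s then Gk gamma l else 1%:M) *m e \in W /\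
  Mon (tensor_mx (fun l => if l \in s then Gk gamma l else 1%:M)).
Proof.
move=> + + Mh hW; elim: s => [_ _|k s IH /= /andP[ks us] cl].
  by rewrite tensor_mx1 mulmx1; split=> //; exact: Mon1.
have [|sW Ms] := IH us; first by move=> l ls; apply: cl; rewrite inE ls orbT.
rewrite -Mk_partial_prod // mulmxA; split; last exact: MonM Ms (Mon_Mk k).
by apply: (cl k _ _ _ sW).1; [exact: mem_head | exact: MonM].
Qed.

(** Let [D] be the full product and [T] the product of the [M k] with [k != p]. First pass from [h]
    to [h D^-1], then multiply by the allowed factors of [T]: the result is
    [h D^-1 T = h (M p)^-1]. *)
Lemma closed_of_Mk_prod p : (forall k, k != p -> translation_closed k) ->
  (v_row *m (Mk_prod *m e)) 0 0 != 0 -> translation_closed p.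
Proof.
move=> cl vp h Mh hW; rewrite translate_Mk_inv //.
pose s := rem p (index_enum 'I_n).
have us : uniq s by rewrite rem_uniq // index_enum_uniq.
have sE k : (k \in s) = (k != p).
  by rewrite mem_rem_uniq ?index_enum_uniq // inE mem_index_enum andbT.
have cls : {in s, forall k, translation_closed k} by move=> k; rewrite sE; exact: cl.
have prodE : tensor_mx (fun l => if l \in s then Gk gamma l else 1%:M) *m M p = Mk_prod.
  rewrite Mk_partial_prod ?sE ?eqxx //; congr tensor_mx; apply/funext => l.
  by rewrite inE sE; case: eqP.
have MD : Mon Mk_prod.
  have [_ Ms] := translate_partial_prod us cls Mh hW.
  by rewrite -prodE; exact: MonM Ms (Mon_Mk p).
have hDW := translate_mem Mh MD hW vp.
have [+ _] := translate_partial_prod us cls (MonM Mh (MonV MD)) hDW.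
set T := tensor_mx _ in prodE *.
suff -> : h *m invmx Mk_prod *m T = h *m invmx (M p) by split.
have -> : T = Mk_prod *m invmx (M p) by rewrite -prodE mulmxK ?Mk_unit.
by rewrite mulmxA mulmxKV ?Mon_unit.
Qed.

(** In each factor [e_1] and [Gk e_1] span the plane, so products of distinct [M k] applied to [e]
    span the whole space. The induction frees one factor at a time and absorbs [M k] into [g]. *)
Lemma translation_closed_full h : (forall k, translation_closed k) ->
  Mon h -> h *m e \in W -> W = fullv.
Proof.
move=> cl Mh hW.
have colW (s : seq 'I_n) : forall u g, (forall k, k \notin s -> u k = col2 0 1) ->
    Mon g -> g *m e \in W -> g *m tensor_col u \in W.
  elim: s => [|k s IH] u g us Mg gW.
    suff -> : tensor_col u = e by [].
    by congr tensor_col; apply/funext => k; rewrite us.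
  pose u1 := upd u k (col2 0 1).
  have u1s l : l \notin s -> u1 l = col2 0 1.
    by move=> ls; rewrite /u1 /upd; case: eqP => // /eqP lk; rewrite us // inE negb_or lk.
  (* In factor [k]: [(x, y) = (x + y) e_1 - x gamma_k Gk e_1]. *)
  have -> : tensor_col u = (u k ord0 0 + u k ord_max 0) *: tensor_col u1 +
      (- (u k ord0 0 * gamma k)) *: (M k *m tensor_col u1).
    rewrite Mk_col /u1 upd_eq upd_upd -tensor_col_linear Gk_col -{1}(upd_id u k).
    congr tensor_col; congr upd; apply/matrixP; apply: forall_ord2 => j;
      rewrite ord1 lincombE !mxE /=; field; exact: gamma0.
  rewrite mulmxDr -!scalemxAr rpredD // rpredZ //; first exact: IH.
  by rewrite mulmxA; apply: IH => //; [exact: MonM Mg (Mon_Mk k) | exact: (cl k _ Mg gW).1].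
apply/eqP; rewrite eqEsubv subvf; apply/subvP => y _.
rewrite -[y](mulKVmx (Mon_unit Mh)) [invmx h *m y]matrix_sum_delta mulmx_sumr.
apply: rpred_sum => i _; rewrite big_ord1 -scalemxAr rpredZ // delta_tensor_col.
by apply: (colW (index_enum 'I_n)) => // k; rewrite mem_index_enum.
Qed.

End StableSubspace.

(** * Values of [v] on some translates of [e] *)

Lemma prod_signs : \prod_(k < n) (-1) = (-1) ^+ n :> F.
Proof. by rewrite prodr_const card_ord. Qed.

Lemma sign_sq : (-1) ^+ n * (-1) ^+ n = 1 :> F.
Proof. by rewrite -expr2 sqrr_sign. Qed.

Lemma v_e : (v_row *m e) 0 0 = 1 + (-1) ^+ n * (\prod_k gamma k) / (alpha * beta).
Proof.
rewrite v_tensor_col; under eq_bigr do rewrite !mxE /= mulr0 sub0r.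
rewrite prod_signs [\prod_k (_ + _)]big1; last by move=> k _; rewrite !mxE add0r.
rewrite [X in _ - _ * X](bigD1 (Ordinal n_gt0)) //= mxE mul0r mulr0 subr0 mulr1.
by rewrite mulrDr sign_sq mulrA.
Qed.

(** Factor [k] has coordinate sum 0 and kills the second tensor of [v]. Another factor, still [e_1],
    kills the third; this is where [n > 1] enters. *)
Lemma v_Mk_e k : (1 < n)%N -> (v_row *m (M k *m e)) 0 0 = 1 + q k.
Proof.
move=> n_gt1; have [l lk] : exists l : 'I_n, l != k.
  have [->|] := eqVneq k (Ordinal n_gt0); first by exists (Ordinal n_gt1).
  by exists (Ordinal n_gt0); rewrite eq_sym.
rewrite Mk_col; set u := upd _ _ _.
have uk : u k = col2 (- q k) (q k) by rewrite /u upd_eq Gk_col mulr1 sub0r.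
have un i : i != k -> u i = col2 0 1 by rewrite /u /upd => /negPf ->.
rewrite v_tensor_col (bigD1 (P := xpredT) k) //= uk.
rewrite (eq_bigr (fun=> -1)); last by move=> i /un ->; rewrite !mxE /= mulr0 sub0r.
rewrite [\prod_j u j _ _](bigD1 l) //= un // !mxE /= mul0r mulr0 subr0.
rewrite [\prod_j (u j _ _ + _)](bigD1 k) //= uk !mxE /= addNr mul0r mulr0 addr0.
rewrite mulrN mulfV //.
have := prod_signs; rewrite (bigD1 k) //=; move: (\prod_(i | i != k) _) => X signX.
by have := sign_sq; rewrite -{2}signX => X1; ring: X1.
Qed.

(** No factor is [e_1] any more, so the third tensor survives and contributes the term in
    [alpha + beta]. *)
Lemma v_Mk_prod_e :
  (v_row *m (Mk_prod *m e)) 0 0 = \prod_k (1 + q k) - (alpha + beta) / (alpha * beta).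
Proof.
have -> : Mk_prod *m e = tensor_col (fun k => col2 (- q k) (q k)).
  rewrite tensor_mx_col; congr tensor_col; apply/funext => k.
  by rewrite Gk_col mulr1 sub0r.
rewrite v_tensor_col.
have -> : \prod_k (gamma k * col2 (- q k) (q k) ord0 0 - col2 (- q k) (q k) ord_max 0) =
    (-1) ^+ n * \prod_k (1 + q k).
  rewrite -prod_signs -big_split; apply: eq_bigr => k _.
  by rewrite !mxE /= mulrN mulfV // mulrDr !mulN1r.
have -> : \prod_k col2 (- q k) (q k) ord0 0 = (-1) ^+ n * (\prod_k gamma k)^-1.
  rewrite -prod_signs -prodfV -big_split; apply: eq_bigr => k _.
  by rewrite !mxE /= mulN1r.
rewrite [\prod_k (col2 _ _ _ _ + _)](bigD1 (Ordinal n_gt0)) //= !mxE /= addNr mul0r mulr0 addr0.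
have sgn := sign_sq; move: (_ ^+ n) sgn => s sgn.
by field: sgn; rewrite alpha0 beta0 prod_gamma_neq0.
Qed.

(** * Closure under each [M k] *)

Section ClosedCases.
Variable W : {vspace 'cV[F]_(2 ^ n)}.
Hypothesis W_stable : forall g w, Ref g -> w \in W -> g *m w \in W.

Lemma one_addV_eq0 (x : F) : x != 0 -> (1 + x^-1 == 0) = (x == -1).
Proof.
move=> x0; rewrite addrC addr_eq0 -{1}invrN1.
by rewrite (inj_eq invr_inj).
Qed.

(** For [n > 1] the value [1 + q k] is nonzero. For [n = 1], if [v M e = 0], then
    [v M^-1 e = (1 + gamma) v e] is used instead. *)
Lemma closed_of_gamma_neqN1 k : gamma k != -1 -> translation_closed W k.
Proof.
move=> gk; have [n_gt1|] := boolP (1 < n)%N.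
  by apply: closed_of_Mk => //; rewrite v_Mk_e // one_addV_eq0.
rewrite -leqNgt => n_le1.
have ord_eq0 (i : 'I_n) : val i = 0%N.
  by apply/eqP; rewrite -leqn0 -ltnS (leq_trans (ltn_ord i)).
have all_k l : l = k by apply: val_inj; rewrite !ord_eq0.
have prod_k (f : 'I_n -> F) : \prod_l f l = f k.
  rewrite (bigD1 k) //= big1 ?mulr1 // => l /negP[].
  by rewrite (all_k l).
have [vM|] := eqVneq ((v_row *m (M k *m e)) 0 0) 0; last exact: closed_of_Mk.
apply: closed_of_Mk_inv => //.
have MkD : M k = Mk_prod.
  by congr tensor_mx; apply/funext => l; rewrite (all_k l) eqxx.
have n1 : n = 1%N by apply/eqP; rewrite eqn_leq n_le1.
have sgn : (-1) ^+ n = -1 :> F by rewrite n1.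
have ve := v_e; rewrite sgn prod_k in ve.
have vM' := vM; rewrite MkD v_Mk_prod_e prod_k in vM'.
have prod0 : \prod_l gamma l ^+ [ffun=> ord0 : 'I_2] l = 1.
  by rewrite big1 // => l _; rewrite ffunE.
have [/eqP nA /eqP nB] := irr [ffun=> ord0]; rewrite prod0 in nA nB.
rewrite Mk_inv mulmxDl -!scalemxAl mulmxDr -!scalemxAr mul1mx lincombE vM mulr0 addr0.
rewrite mulf_neq0 //; first by rewrite addrC addr_eq0.
rewrite ve; apply/eqP => v0.
(* If [v e] and [v M e] both vanished, this combination of them would give [alpha = 1] or
   [beta = 1], against irreducibility at [I = 0]. *)
have : (alpha - 1) * (beta - 1) == 0.
  rewrite (_ : _ * _ = alpha * beta * (1 + q k - (alpha + beta) / (alpha * beta))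
    - alpha * beta * q k * (1 + -1 * gamma k / (alpha * beta))).
    by rewrite v0 vM' !mulr0 subrr.
  by field; rewrite gamma0 alpha0 beta0.
by rewrite mulf_eq0 !subr_eq0 (negPf nA) (negPf nB).
Qed.

(** The factor [1 + q p] vanishes, so [v] takes the value [- (alpha + beta) / (alpha beta)] on the
    full product applied to [e]. *)
Lemma closed_of_ratio_neqN1 p : alpha / beta != -1 ->
  (forall k, k != p -> gamma k != -1) -> gamma p = -1 -> translation_closed W p.
Proof.
move=> ab gk gp; apply: closed_of_Mk_prod => // [k kp|].
  exact/closed_of_gamma_neqN1/gk.
rewrite v_Mk_prod_e (bigD1 p) //= gp invrN1 subrr mul0r sub0r oppr_eq0.
rewrite mulf_neq0 ?invr_eq0 ?mulf_neq0 //; apply: contraNneq ab => /eqP.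
by rewrite addr_eq0 => /eqP ->; rewrite mulNr mulfV.
Qed.

End ClosedCases.

Lemma Ref_irreducible :
  (#|[set k | (gamma k == -1)%R]%SET| + (alpha / beta == -1)%R <= 1)%N ->
  irreducible_action Ref.
Proof.
move=> count1; split; first by rewrite expn_gt0.
move=> W W_stable; have [->|[h Mh hW]] := stable_trivial_or_orbit W_stable; first by left.
right; apply: (translation_closed_full _ Mh hW) => // p.
have [gp|] := eqVneq (gamma p) (-1); last exact: closed_of_gamma_neqN1.
have pS : p \in [set k | gamma k == -1]%SET by rewrite inE gp.
apply: closed_of_ratio_neqN1 => //.
  apply/negP => ab; move: count1; rewrite ab (cardD1 p) pS.
  by rewrite addnC.
move=> k kp; apply/negP => gk; move: count1; rewrite (cardD1 p) pS (cardD1 k).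
by rewrite !inE kp gk.
Qed.

(** * The reducible case *)

Section Reducible.
Variable S : {set 'I_n}.
Hypotheses (char_neq2 : 2 != 0 :> F) (gammaS : {in S, forall k, gamma k = -1}).

(* In the basis [e_1, e_0 - e_1] this is diag(1, -1), while [Gk] with
   [gamma k = -1] exchanges the two basis vectors. *)
Definition swap_sign : 'M[F]_2 := \matrix_(i, j)
  (if i == ord0 then if j == ord0 then -1 else 0 else if j == ord0 then 2 else 1).

(** The involution [J]; [S] will consist of one or two factors. *)
Definition grading : 'M[F]_(2 ^ n) :=
  tensor_mx (fun k => if k \in S then swap_sign else 1%:M).

Lemma swap_sign_col x y : swap_sign *m col2 x y = col2 (- x) (2 * x + y).
Proof. by apply/matrixP; apply: forall_ord2 => j; rewrite !mxE big_ord2 !mxE /=; ring. Qed.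

Lemma row_swap_sign x y : row2 x y *m swap_sign = row2 (- x + 2 * y) y.
Proof. by apply/matrixP => i; apply: forall_ord2; rewrite !mxE big_ord2 !mxE /=; ring. Qed.

Lemma grading_e : grading *m e = e.
Proof.
rewrite tensor_mx_col; congr tensor_col; apply/funext => k.
case: ifP => _; last by rewrite mul1mx.
by rewrite swap_sign_col oppr0 mulr0 add0r.
Qed.

(** On [S], [swap_sign] fixes the rows [(-1, -1)] and [(1, 1)] and negates [(1, 0)]. The third
    tensor thus acquires the sign [(-1)^|S|], which is harmless if it is 1 or if the coefficient
    [alpha + beta] is 0. *)
Lemma v_grading : (-1) ^+ #|S| = 1 :> F \/ alpha + beta = 0 -> v_row *m grading = v_row.
Proof.
move=> S_even; rewrite v_rowE -!scalemxAl mulmxBl mulmxDl -!scalemxAl.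
rewrite !tensor_row_mx; congr (_ *: (tensor_row _ + _ *: tensor_row _ - _)).
- apply/funext => k; case: ifP => [/gammaS ->|_]; last by rewrite mulmx1.
  by rewrite row_swap_sign; congr row2; ring.
- apply/funext => k; case: ifP => _; last by rewrite mulmx1.
  by rewrite row_swap_sign; congr row2; ring.
case: S_even => [S_even|->]; last by rewrite !mul0r !scale0r.
have signS : (-1) ^+ #|S| = \prod_k (if k \in S then -1 else 1) :> F.
  by rewrite -big_mkcond prodr_const.
congr (_ *: _); apply/matrixP => i j; rewrite !mxE.
rewrite -[RHS]mul1r -[X in X * _]S_even signS -big_split.
apply: eq_bigr => k _ /=; case: ifP => _; last by rewrite mulmx1 mul1r.
rewrite row_swap_sign mulr0 addr0 !mxE; case: ifP => _; first by rewrite mulN1r.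
by rewrite mulr0.
Qed.

Lemma grading_Mk k : M k *m grading = (-1) ^+ (k \in S) *: (grading *m M k).
Proof.
rewrite MkE !tensor_mxM.
(* The zero summand gives the right side the shape expected by [tensor_mx_linear]. *)
have swap : k \in S -> Gk gamma k *m swap_sign = (-1) *: (swap_sign *m Gk gamma k) + 0 *: 1%:M.
  move/gammaS => gk; rewrite GkE gk invrN1.
  by apply/matrixP; apply: forall_ord2; apply: forall_ord2;
    rewrite lincombE !mxE !big_ord2 !mxE /=; ring.
pose B := fun l => if l \in S then swap_sign else 1%:M.
have -> : (fun l => upd (fun=> 1%:M) k (Gk gamma k) l *m B l) = upd B k (Gk gamma k *m B k).
  by apply/funext => l; rewrite /upd; case: eqP => [->|_]; rewrite ?mul1mx.
have -> : (fun l => B l *m upd (fun=> 1%:M) k (Gk gamma k) l) = upd B k (B k *m Gk gamma k).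
  by apply/funext => l; rewrite /upd; case: eqP => [->|_]; rewrite ?mulmx1.
rewrite (erefl : B k = if k \in S then swap_sign else 1%:M).
case: ifP => [/swap ->|_]; last by rewrite mulmx1 mul1mx scale1r.
by rewrite tensor_mx_linear scale0r addr0.
Qed.

Lemma Mon_grading g : (-1) ^+ #|S| = 1 :> F \/ alpha + beta = 0 -> Mon g ->
  exists b : bool, g *m grading = (-1) ^+ b *: (grading *m g).
Proof.
(* Invertibility belongs to [H] because closure under [invmx] is proved by cancelling [h]. *)
move=> S_even; pose H := [set g : 'M[F]_(2 ^ n) | g \in unitmx /\
  exists b : bool, g *m grading = (-1) ^+ b *: (grading *m g)].
suff sMH : Mon `<=` H by move=> /sMH[].
apply: Mon_min => [||k]; last first.
- by split; [exact: Mk_unit | exists (k \in S); exact: grading_Mk].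
- split; first exact: M0_unit.
  exists false; rewrite scale1r M0E mulmxBr mulmxBl mulmx1 mul1mx.
  by rewrite -mulmxA v_grading // mulmxA grading_e.
split=> [h []//||h m [uh [b hb]] [um [c mc]]|h [uh [b hb]]].
- by split; [exact: unitmx1 | exists false; rewrite scale1r mulmx1 mul1mx].
- split; first by rewrite unitmx_mul uh um.
  exists (b (+) c); rewrite -mulmxA mc -scalemxAr (mulmxA h) hb -scalemxAl scalerA.
  by rewrite -signr_addb addbC !mulmxA.
split; first by rewrite unitmx_inv.
exists b; apply: (can_inj (mulKmx uh)); rewrite mulKVmx //.
by rewrite -scalemxAr (mulmxA h) hb -scalemxAl scalerA -signr_addb addbb scale1r mulmxK.
Qed.

(** In [h k h^-1] the signs of [h] and of its inverse cancel, so the elements of [Mon] commuting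
    with [grading] form a normal subgroup; it contains [M0]. *)
Lemma Ref_grading g : (-1) ^+ #|S| = 1 :> F \/ alpha + beta = 0 -> Ref g ->
  g *m grading = grading *m g.
Proof.
move=> S_even; pose K := [set g | Mon g /\ g *m grading = grading *m g].
suff sRK : Ref `<=` K by move=> /sRK[].
move=> {}g; apply; split; last first.
  move=> _ ->; split; first exact: Mon_M0.
  rewrite M0E mulmxBr mulmxBl mulmx1 mul1mx.
  by rewrite -mulmxA v_grading // mulmxA grading_e.
split=> [|h []//|h k Mh [Mk kJ]].
  split=> [h [Mh _]||h k [Mh hJ] [Mk kJ]|h [Mh hJ]]; first exact: Mon_unit.
  - by split; [exact: Mon1 | rewrite mulmx1 mul1mx].
  - by split; [exact: MonM | rewrite -mulmxA kJ mulmxA hJ mulmxA].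
  split; first exact: MonV.
  apply: (can_inj (mulKmx (Mon_unit Mh))); rewrite mulKVmx ?Mon_unit //.
  by rewrite mulmxA hJ mulmxK ?Mon_unit.
split; first exact: MonM (MonM Mh Mk) (MonV Mh).
have [b hb] := Mon_grading S_even Mh; apply: (can_inj (mulmxK (Mon_unit Mh))).
have hb' : grading *m h = (-1) ^+ b *: (h *m grading).
  by rewrite hb scalerA -signr_addb addbb scale1r.
rewrite -(mulmxA _ grading) hb' -scalemxAr !mulmxA !(mulmxKV (Mon_unit Mh)).
by rewrite -(mulmxA h) kJ (mulmxA h) hb -scalemxAl
  scalerA -signr_addb addbb scale1r.
Qed.

Lemma Ref_reducible : (-1) ^+ #|S| = 1 :> F \/ alpha + beta = 0 ->
  (exists p, p \in S) -> ~ irreducible_action Ref.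
Proof.
move=> S_even [p pS] [_ irrR].
pose W := lker (linfun (mulmx (grading - 1%:M) : 'cV[F]_(2 ^ n) -> 'cV[F]_(2 ^ n))).
have memW w : (w \in W) = (grading *m w == w).
  by rewrite memv_ker lfunE /= mulmxBl mul1mx subr_eq0.
have [|W0|W1] := irrR W.
- by move=> g w Rg; rewrite !memW mulmxA -Ref_grading // -mulmxA => /eqP ->.
- have : e \in W by rewrite memW grading_e.
  rewrite W0 memv0 => /eqP e0.
  have := tensor_row_col (fun=> row2 0 1) (fun=> col2 0 1) : (_ *m e) 0 0 = _.
  rewrite e0 mulmx0 mxE big1 => [/eqP|k _]; first by rewrite eq_sym oner_eq0.
  by rewrite !mxE /= mul0r mul1r add0r.
(* This vector is not fixed: its coordinate at [(1,...,1)] is 0, while that of its image is 2. *)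
pose y := upd (fun=> col2 0 1 : 'cV[F]_2) p (col2 1 0).
have : tensor_col y \in W by rewrite W1 memvf.
rewrite memW => /eqP /(congr1 (fun x => (tensor_row (fun=> row2 0 1) *m x) 0 0)) /eqP.
rewrite tensor_mx_col !tensor_row_col.
rewrite [X in _ == X](bigD1 p) //= /y upd_eq !mxE /= mul0r mulr0 add0r mul0r.
apply/negP/prodf_neq0 => k _; rewrite /upd; have [->|_] := eqVneq k p.
  by rewrite pS swap_sign_col !mxE /= mul0r mul1r mulr1 addr0 add0r.
case: ifP => _; rewrite ?mul1mx ?swap_sign_col !mxE /= mul0r mul1r ?mulr0 !add0r;
  exact: oner_neq0.
Qed.

End Reducible.

(** * The equivalence *)

Lemma irreducible_iff : 2 != 0 :> F ->
  irreducible_action Ref <->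
  (#|[set k | (gamma k == -1)%R]%SET| + (alpha / beta == -1)%R <= 1)%N.
Proof.
move=> two0; split; last exact: Ref_irreducible.
apply: contraPT; rewrite -ltnNge => count2.
(* If [alpha / beta = -1], a single factor with [gamma p = -1] suffices because [alpha + beta = 0];
   otherwise two such factors make [|S|] even. *)
have [ab|nab] := eqVneq (alpha / beta) (-1).
  move: count2; rewrite ab eqxx addn1 ltnS => /card_gt0P[p].
  rewrite inE => /eqP gp; apply: (@Ref_reducible [set p]%SET) => //.
  - by move=> k; rewrite inE => /eqP ->.
  - right; apply/eqP; rewrite addr_eq0 -[X in X == _](divfK beta0) ab mulN1r //.
  - by exists p; rewrite inE.
move: count2; rewrite (negPf nab) addn0 => /card_gt1P[p [l []]].
rewrite !inE => /eqP gp /eqP gl pl; apply: (@Ref_reducible [set p; l]%SET) => //.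
- by move=> k; rewrite !inE => /orP[] /eqP ->.
- by left; rewrite cards2 pl expr2 mulrNN mulr1.
- by exists p; rewrite !inE eqxx.
Qed.

End MonodromyFacts.

Unset Implicit Arguments.

Theorem theorem2p2 (R : realType) (n : nat) (hn : (1 <= n)%N)
    (a b : R[i]) (c : 'I_n -> R[i]) :
  let alpha := exp2pii a in
  let beta := exp2pii b in
  let gamma := fun k : 'I_n => exp2pii (c k) in
  (forall I : {ffun 'I_n -> 'I_2},
      alpha <> \prod_(k < n) gamma k ^+ I k /\
      beta <> \prod_(k < n) gamma k ^+ I k) ->
  irreducible_action (Ref alpha beta gamma) <->
  (#|[set k : 'I_n | (gamma k == -1)%R]%SET| + (alpha * beta^-1 == -1)%R <= 1)%N.
Proof.
move=> alpha beta gamma irr; apply: irreducible_iff => //; try exact: exp2pii_neq0.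
by move=> k; exact: exp2pii_neq0.
Qed.
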